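(* Let $n\geq 3$ be a natural number and let $\Lambda$ be a cyclotomic model set with underlying $\mathbb{Z}$-module $\mathcal{O}_n$. Suppose that there exists a natural number $k\in\mathbb{N}$ such that, for every set $U$ of $k$ pairwise non-parallel $\Lambda$-directions, the set $\mathcal{C}(\Lambda)$ is determined by the $X$-rays in the directions of $U$. Then $$k>\max\left\{3,\tfrac{\operatorname{lcm}(n,2)}{2}\right\}.$$
   Context: $\mathbb{N}=\{1,2,3,\dots\}$; $\mathbb{R}^2$ is identified with $\mathbb{C}$. For $n\in\mathbb{N}$: $\zeta_n:=e^{2\pi i/n}$, $\mathbb{K}_n:=\mathbb{Q}(\zeta_n)$ and $\mathcal{O}_n:=\mathbb{Z}[\zeta_n]$; $\phi$ is Euler's function. Cyclotomic model sets: let $n\ge 3$. Choose automorphisms $\sigma_1=\mathrm{id},\sigma_2,\dots,\sigma_{\phi(n)/2}$ of $\mathbb{K}_n/\mathbb{Q}$ by picking exactly one from each pair of complex conjugate automorphisms, and let the star map $\star:\mathcal{O}_n\to(\mathbb{R}^2)^{\phi(n)/2-1}$ be $z\mapsto z^\star:=(\sigma_2(z),\dots,\sigma_{\phi(n)/2}(z))$ (for $n\in\{3,4,6\}$ the target is the one-point space $\{0\}$ and the star map is the zero map). A window is a set $W\subset(\mathbb{R}^2)^{\phi(n)/2-1}$ with $\emptyset\neq \operatorname{int}(W)\subset W\subset\overline{\operatorname{int}(W)}$ and $\overline{\operatorname{int}(W)}$ compact. A cyclotomic model set with underlying $\mathbb{Z}$-module $\mathcal{O}_n$ is a set of the form $\Lambda=t+\{z\in\mathcal{O}_n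 \mid z^\star\in W\}$ with $t\in\mathbb{R}^2$, $W$ a window, and $\star$ any such star map. A direction is an element $u$ of the unit circle $\mathbb{S}^1\subset\mathbb{R}^2$; it is a $\Lambda$-direction if it is parallel to a non-zero element of $\Lambda-\Lambda=\{s-s'\mid s,s'\in\Lambda\}$. A convex subset of $\Lambda$ is a finite set $C\subset\Lambda$ with $C=\operatorname{conv}(C)\cap\Lambda$; $\mathcal{C}(\Lambda)$ denotes the set of all convex subsets of $\Lambda$. For a finite set $F\subset\mathbb{R}^2$ and a direction $u$, let $\mathcal{L}_u$ be the set of lines in $\mathbb{R}^2$ in direction $u$; the (discrete parallel) $X$-ray of $F$ in direction $u$ is the function $X_uF:\mathcal{L}_u\to\mathbb{N}\cup\{0\}$, $X_uF(\ell):=\operatorname{card}(F\cap\ell)$. A family $\mathcal{E}$ of finite subsets of $\mathbb{R}^2$ is determined by the $X$-rays in the directions of a finite set $U\subset\mathbb{S}^1$ if for all $F,F'\in\mathcal{E}$: $X_uF=X_uF'$ for all $u\in U$ implies $F=F'$. *)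

(* Defs.v *)
From mathcomp Require Import all_boot all_order all_algebra.
From mathcomp Require Import finmap complex.
From mathcomp Require Import all_classical all_reals all_analysis.

Set Implicit Arguments.
Unset Strict Implicit.
Unset Printing Implicit Defensive.

Import numFieldNormedType.Exports.
Import Order.TTheory GRing.Theory Num.Theory.

Local Open Scope ring_scope.
Local Open Scope classical_set_scope.

Section CyclotomicModelSets.
Context {R : realType}.

(* R^2 identified with C; R[i]^o carries the topology of the complex modulus. *)
Local Notation C := (R[i]^o).

Section CyclotomicField.
Variable n : nat.

(* e^(2 pi i / n) *)
Definition zeta : C := (cos (2 * pi / n%:R) +i* sin (2 * pi / n%:R))%C.

(* Q(zeta): the prime field Q lies in every subfield of C. *)
Definition cyclotomic_field : set C :=
  smallest (fun F : set C => divring_closed (mem F)) [set zeta].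

(* Z[zeta] *)
Definition cyclotomic_integers : set C :=
  [set z | exists p : {poly int}, z = (map_poly intr p).[zeta]].

(* Automorphisms of Q(zeta)/Q are represented by total functions on C, of
   which only the values on Q(zeta) are relevant. *)
Definition cyclotomic_automorphism (f : C -> C) : Prop :=
  [/\ set_bij cyclotomic_field cyclotomic_field f,
      forall q : rat, f (ratr q) = ratr q,
      {in cyclotomic_field &, forall x y, f (x + y) = f x + f y} &
      {in cyclotomic_field &, forall x y, f (x * y) = f x * f y}].

(* phi(n)/2 - 1, so that the internal space is C^internal_dim; it is the
   one-point space 'rV_0 for n = 3, 4, 6. *)
Definition internal_dim : nat := (totient n)./2.-1.

(* s = (sigma_1 = id, ..., sigma_(phi(n)/2)), shifted to start at index 0,
   with exactly one member in each pair {f, conj o f} of automorphisms. *)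
Definition conjugate_representatives
    (s : 'I_internal_dim.+1 -> C -> C) : Prop :=
  [/\ {in cyclotomic_field, s ord0 =1 id},
      forall j, cyclotomic_automorphism (s j) &
      forall f, cyclotomic_automorphism f ->
        exists! j, {in cyclotomic_field, s j =1 f} \/
                   {in cyclotomic_field, s j =1 (fun z => (f z)^*%C)}].

Definition star_map (s : 'I_internal_dim.+1 -> C -> C) (z : C) :
    'rV[C]_internal_dim :=
  \row_j s (lift ord0 j) z.

End CyclotomicField.

Definition window m (W : set 'rV[C]_m) : Prop :=
  [/\ W° !=set0, W° `<=` W, W `<=` closure W° & compact (closure W°)].

Definition cyclotomic_model_set n (L : set C) : Prop :=
  exists (s : 'I_(internal_dim n).+1 -> C -> C) (t : C)
         (W : set 'rV[C]_(internal_dim n)),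
    [/\ conjugate_representatives s, window W &
        L = [set t + z | z in
              [set z | cyclotomic_integers n z /\ W (star_map s z)]]].

Definition direction (u : C) : Prop := `|u| = 1.

Definition parallel (x y : C) : Prop :=
  exists2 c : R, c != 0 & y = c%:C%C * x.

Definition model_direction (L : set C) (u : C) : Prop :=
  direction u /\
  exists x y, [/\ L x, L y, x - y != 0 & parallel (x - y) u].

(* Rcomplex R is R[i] seen as a real vector space. *)
Definition convex_hull (A : set C) : set C :=
  smallest (@convex_set R (Rcomplex R)) A.

Definition convex_subsets (L : set C) : set (set C) :=
  [set A | [/\ finite_set A, A `<=` L & A = convex_hull A `&` L]].

Definition lines (u : C) : set (set C) :=
  [set [set a + c%:C%C * u | c in [set: R]] | a in [set: C]].

(* fset_set is the junk value fset0 on infinite sets: F is meant finite. *)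
Definition Xray (u : C) (F : set C) : lines u -> nat :=
  fun l => #|` fset_set (F `&` set_val l)|.

Definition determined_by_Xrays (E : set (set C)) (U : set C) : Prop :=
  forall F F' : set C, E F -> E F' ->
    (forall u, U u -> @Xray u F = @Xray u F') -> F = F'.

End CyclotomicModelSets.

(* Main.v *)
Require Import Defs.
From mathcomp Require Import all_boot all_order all_algebra.
From mathcomp Require Import complex.
From mathcomp Require Import all_classical all_reals all_analysis.
From mathcomp Require Import all_fingroup all_solvable cyclotomic finmap.
From mathcomp Require Import zify ring lra.
Import numFieldNormedType.Exports.
Import Order.TTheory GRing.Theory Num.Theory.

Local Open Scope ring_scope.
Local Open Scope classical_set_scope.

(* Even k > n holds, and n >= max(3, lcm(n,2)/2).  Choose a in Z[zeta] such
   that a and its conjugate do not differ by a power of zeta.  The orbits of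
   z0 + al a and of z0 + al conj(a) under rotation by zeta about z0 are disjoint
   subsets of one circle, and they are exchanged by n reflections whose axes
   pass through z0.  Hence the two sets obtained from the points of L in the
   closed disc by deleting one orbit or the other have equal X-rays in the n
   directions orthogonal to these axes; both are convex in L because a disc
   stays convex when boundary points are removed.
   It remains to place both orbits in L, i.e. to make the star image of Z[zeta]
   dense and to find al with small conjugates, and to see that L meets a disc in
   a finite set.  All three follow from the invertibility of the Vandermonde
   matrix at the phi(n) points sigma_j(zeta), conj(sigma_j(zeta)). *)

Set Implicit Arguments.
Unset Strict Implicit.
Unset Printing Implicit Defensive.

(** * Vandermonde matrices and polynomial interpolation *)

Lemma Vandermonde_unitmx (F : fieldType) d (a : 'rV[F]_d) :
  injective (a 0) -> Vandermonde d a \in unitmx.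
Proof.
move=> inja; rewrite unitmxE unitfE det_Vandermonde prodf_seq_neq0.
apply/allP => i _ /=; rewrite prodf_seq_neq0; apply/allP => j _ /=.
by apply/implyP => ij; rewrite subr_eq0 (inj_eq inja) gt_eqF.
Qed.

Lemma mul_Vandermonde (F : fieldType) d (a : 'rV[F]_d) (q : {poly F}) j :
  (size q <= d)%N -> ((\row_(i < d) q`_i) *m Vandermonde d a) 0 j = q.[a 0 j].
Proof.
move=> sq; rewrite mxE (horner_coef_wide _ sq).
by apply: eq_bigr => i _; rewrite !mxE.
Qed.

Lemma interpolation (F : fieldType) d (a : 'rV[F]_d) (w : 'I_d -> F) :
  injective (a 0) ->
  exists2 q : {poly F}, (size q <= d)%N & forall j, q.[a 0 j] = w j.
Proof.
move=> inja; pose c := \row_j w j *m invmx (Vandermonde d a).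
exists (rVpoly c); first exact: size_poly.
move=> j; rewrite -mul_Vandermonde ?size_poly //.
have -> : \row_(i < d) (rVpoly c)`_i = c.
  by apply/rowP => i; rewrite mxE coef_rVpoly_ord.
by rewrite mulmxKV ?Vandermonde_unitmx // mxE.
Qed.

(** The coefficients are recovered linearly from the values by the inverse Vandermonde matrix; [K]
    is the sum of the absolute values of its entries. *)
Lemma coef_le_values (F : numFieldType) d (a : 'rV[F]_d) :
  injective (a 0) ->
  exists2 K : F, 0 <= K &
    forall (q : {poly F}) (B : F), (size q <= d)%N ->
      (forall j, `|q.[a 0 j]| <= B) -> forall i : 'I_d, `|q`_i| <= K * B.
Proof.
move=> inja; pose V' := invmx (Vandermonde d a).
exists (\sum_i \sum_j `|V' i j|) => [|q B sq qB i].
  by do 2![apply: sumr_ge0 => ? _].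
have -> : q`_i = ((\row_(i < d) q`_i) *m Vandermonde d a *m V') 0 i.
  by rewrite mulmxK ?Vandermonde_unitmx // mxE.
rewrite mxE (le_trans (ler_norm_sum _ _ _)) // mulr_suml ler_sum // => j _.
rewrite mul_Vandermonde // normrM mulrC ler_pM //.
rewrite (bigD1 i) //= lerDl.
exact: sumr_ge0.
Qed.

(** * Simultaneous approximation by values of integer polynomials *)

Section Approximation.
Context {R : realType}.
Local Notation C := R[i].
Local Notation ev p z := (map_poly (intr : int -> C) p).[z].
Local Notation evR q z := (map_poly (real_complex R) q).[z].

Lemma conj_ev (p : {poly int}) (z : C) : (ev p z)^*%C = ev p z^*%C.
Proof.
rewrite -horner_map -map_poly_comp; congr (_.[_]).
by apply: eq_map_poly => k /=; rewrite rmorph_int.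
Qed.

Definition conj_points k (x : 'I_k -> C) : 'rV[C]_(k + k) :=
  row_mx (\row_j x j) (\row_j (x j)^*%C).

Lemma conj_points_inj k (x : 'I_k -> C) :
  injective x -> (forall i j, x i != (x j)^*%C) -> injective (conj_points x 0).
Proof.
move=> injx xNJ i i' e; apply: (can_inj splitK).
rewrite -(splitK i) -(splitK i') in e *.
case: (fintype.split i) (fintype.split i') e => [] j [] j' /=.
- by rewrite !row_mxEl !mxE => /injx ->.
- by rewrite row_mxEl row_mxEr !mxE => e; have := xNJ j j'; rewrite e eqxx.
- by rewrite row_mxEl row_mxEr !mxE => e; have := xNJ j' j; rewrite -e eqxx.
- by rewrite !row_mxEr !mxE => /(can_inj (@conjcK R))/injx ->.
Qed.

(** Interpolate [w j] at [x j] and the conjugate values at the conjugate points. Averaging the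
    result with its coefficientwise conjugate keeps the values at the [x j] and makes the
    coefficients real. *)
Lemma real_interpolation k (x w : 'I_k -> C) :
  injective x -> (forall i j, x i != (x j)^*%C) ->
  exists2 q : {poly R}, (size q <= k + k)%N & forall j, evR q (x j) = w j.
Proof.
move=> injx xNJ.
have [q sq qE] := interpolation (conj_points w 0) (conj_points_inj injx xNJ).
exists (map_poly (@complex.Re R) q) => [|j].
  exact: leq_trans (size_poly _ _) sq.
have qx : q.[x j] = w j.
  by have := qE (lshift k j); rewrite /conj_points !row_mxEl !mxE.
have qJ : (map_poly (@conjc R) q).[x j] = w j.
  have := qE (rshift k j); rewrite /conj_points !row_mxEr !mxE.
  by move=> /(congr1 (@conjc R)); rewrite -horner_map /= !conjcK.
have -> : map_poly (real_complex R) (map_poly (@complex.Re R) q) =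
    2^-1 *: (q + map_poly (@conjc R) q).
  apply/polyP => i; rewrite coef_map /= coef_map_id0 // coefZ coefD coef_map.
  by rewrite ReJ_add mulrC.
by rewrite hornerZ hornerD qx qJ -mulr2n -[w j *+ 2]mulr_natl mulKf ?pnatr_eq0.
Qed.

(** Each coefficient moves by at most 1 and is multiplied by a power of [z] of modulus at most 1. *)
Lemma rounding (q : {poly R}) :
  exists p : {poly int}, forall z : C, `|z| <= 1 ->
    `|ev p z - evR q z| <= (size q)%:R.
Proof.
exists (map_poly Num.floor q) => z z1.
rewrite -map_poly_comp_id0 ?floor0 //.
rewrite -hornerN -hornerD; set r := _ + _.
have rE i : r`_i = (((Num.floor q`_i)%:~R - q`_i)%:C)%C.
  rewrite coefD coefN !coef_map_id0 //= ?floor0 //.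
  by rewrite rmorphB /= rmorph_int.
have sr : (size r <= size q)%N.
  apply/leq_sizeP => j qj; rewrite rE nth_default //.
  by rewrite floor0 subrr.
rewrite (horner_coef_wide _ sr) (le_trans (ler_norm_sum _ _ _)) //.
have -> : (size q)%:R = \sum_(i < size q) (1 : C).
  by rewrite sumr_const card_ord.
rewrite ler_sum // => j _; rewrite normrM -[leRHS]mulr1 ler_pM //; last first.
  by rewrite normrX exprn_ile1.
rewrite rE normc_def /= expr0n addr0 sqrtr_sqr lecR distrC ger0_norm.
  by have /ltW := floorD1_gt q`_j; rewrite intrD lerBlDl.
by rewrite subr_ge0 floor_le.
Qed.

Lemma normc_le_Re_Im (z : C) : `|z| <= (`|complex.Re z| + `|complex.Im z|)%:C%C.
Proof.
case: z => a b; rewrite normc_def lecR /=.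
rewrite -[leRHS]ger0_norm ?addr_ge0 // -sqrtr_sqr ler_wsqrtr //.
rewrite -(real_normK (num_real a)) -(real_normK (num_real b)).
by have := normr_ge0 a; have := normr_ge0 b; nra.
Qed.

Lemma normc_ge_Im (z : C) : `|complex.Im z|%:C%C <= `|z|.
Proof.
case: z => a b; rewrite normc_def lecR /= -sqrtr_sqr ler_wsqrtr //.
by rewrite lerDr sqr_ge0.
Qed.

Lemma floor_eq_close (y y' : R) : Num.floor y = Num.floor y' -> `|y - y'| < 1.
Proof.
move=> e; rewrite ltr_norml ltrBrDl ltrBlDl.
have := floor_le y; have := floorD1_gt y; have := floor_le y'.
have := floorD1_gt y'; rewrite e !intrD => h1 h2 h3 h4.
apply/andP; split; lra.
Qed.

(** Pigeonhole principle: real and imaginary parts are sorted into finitely many intervals of length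
    [e / 2]. *)
Lemma bounded_seq_close m (u : nat -> 'I_m -> C) (B e : R) :
  (forall t j, `|u t j| <= B%:C%C) -> 0 < e ->
  exists t t', (t < t')%N /\ forall j, `|u t j - u t' j| < e%:C%C.
Proof.
move=> uB e0.
pose N := 2 / e; have N0 : 0 < N by rewrite divr_gt0.
pose M := (`|Num.floor (2 * B * N)|%N).+1.
(* The index stays below [M] whenever [y] lies in [-B, B], so [inord] never falls back on its
   default there. *)
pose cell (y : R) : 'I_M := inord `|Num.floor ((y + B) * N)|%N.
have cell_ge0 y : `|y| <= B -> 0 <= (y + B) * N.
  rewrite ler_norml => /andP[yB _].
  by rewrite mulr_ge0 ?(ltW N0) // -lerBlDr sub0r.
have cell_lt y : `|y| <= B -> (`|Num.floor ((y + B) * N)|%N < M)%N.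
  move=> yB; rewrite ltnS -lez_nat !gez0_abs ?floor_ge0 ?cell_ge0 //.
    by rewrite le_floor // ler_wpM2r ?(ltW N0) //; have := ler_norm y; lra.
  by rewrite mulr_ge0 ?(ltW N0) // mulr_ge0 // (le_trans _ yB).
have cellP y y' : `|y| <= B -> `|y'| <= B -> cell y = cell y' ->
    `|y - y'| < e / 2.
  move=> yB y'B /(congr1 val); rewrite /= !inordK ?cell_lt //.
  move=> /(congr1 Posz); rewrite !gez0_abs ?floor_ge0 ?cell_ge0 //.
  move=> /floor_eq_close; rewrite -mulrBl opprD addrACA subrr addr0.
  by rewrite normrM (gtr0_norm N0) -ltr_pdivlMr // mul1r invf_div.
pose F := {ffun 'I_m -> 'I_M * 'I_M}.
pose f (t : 'I_#|F|.+1) : F :=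
  [ffun j => (cell (complex.Re (u t j)), cell (complex.Im (u t j)))].
have /injectivePn[t [t' tt' ff']] : ~~ injectiveb f.
  apply/negP => /injectiveP /leq_card; rewrite card_ord.
  by rewrite ltnn.
have close j : `|u t j - u t' j| < e%:C%C.
  have := congr1 (fun g : F => g j) ff'; rewrite !ffunE => -[eR eI].
  apply: le_lt_trans (normc_le_Re_Im _) _; rewrite ltcR (splitr e) !raddfB /=.
  have [uR uR'] : `|complex.Re (u t j)| <= B /\ `|complex.Re (u t' j)| <= B.
    by split; rewrite -lecR (le_trans (normc_ge_Re _)).
  have [uI uI'] : `|complex.Im (u t j)| <= B /\ `|complex.Im (u t' j)| <= B.
    by split; rewrite -lecR (le_trans (normc_ge_Im _)).
  by rewrite ltrD // cellP.
have [lt|lt|/val_inj e'] := ltngtP t t'.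
- by exists t, t'.
- by exists t', t; split=> // j; rewrite distrC.
- by rewrite e' eqxx in tt'.
Qed.

Variables (m : nat) (x : 'I_m.+1 -> C).
Hypotheses (injx : injective x) (xNJ : forall i j, x i != (x j)^*%C).
Hypothesis x_le1 : forall j, `|x j| <= 1.

(* Rounding a real polynomial that takes a huge value at x_0 and vanishes at
   the other x_j produces infinitely many integer polynomials bounded at these
   other points. *)
Lemma small_conjugates (e : R) : 0 < e ->
  exists2 p : {poly int}, ev p (x ord0) != 0 &
    forall j, `|ev p (x (lift ord0 j))| < e%:C%C.
Proof.
move=> e0; pose d := (m.+1 + m.+1)%N.
(* The spacing 2d + 1 exceeds twice the rounding error d, so distinct [t] yield distinct values at
   x_0. *)
pose w (t : nat) (j : 'I_m.+1) : C := if j == ord0 then (t * d.*2.+1)%:R else 0.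
have /choice[p pw] : forall t, exists p : {poly int},
    forall j, `|ev p (x j) - w t j| <= d%:R.
  move=> t; have [q sq qw] := real_interpolation (w t) injx xNJ.
  have [p pq] := rounding q; exists p => j.
  by rewrite -qw (le_trans (pq _ _)) // ler_nat.
have uB t j : `|ev (p t) (x (lift ord0 j))| <= (d%:R)%:C%C.
  by have := pw t (lift ord0 j); rewrite /w /= subr0 rmorph_nat.
have [t [t' [tt' close]]] := bounded_seq_close uB e0.
exists (p t - p t') => [|j]; last first.
  by rewrite rmorphB hornerD hornerN.
rewrite rmorphB hornerD hornerN subr_eq0; apply/eqP => e'.
have := ler_distD (ev (p t) (x ord0)) (w t' ord0) (w t ord0).
rewrite {1}e' [X in _ <= X + _]distrC.
move=> /le_trans /(_ (lerD (pw t' _) (pw t _))).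
rewrite -natrD /w eqxx -natrB ?leq_mul2r ?(ltnW tt') ?orbT //.
rewrite normr_nat ler_nat addnn -mulnBl.
by rewrite leqNgt leq_pmull // subn_gt0.
Qed.

Hypothesis ev_eq0 : forall p j, (ev p (x j) == 0) = (ev p (x ord0) == 0).

(** Interpolate the quotients of [w] by the conjugates of some [a], round, and multiply back by [a]:
    the rounding error d is scaled by conjugates of [a] smaller than e / d. *)
Lemma dense_conjugates (w : 'I_m -> C) (e : R) : 0 < e ->
  exists p : {poly int}, forall j, `|ev p (x (lift ord0 j)) - w j| < e%:C%C.
Proof.
move=> e0; pose d := (m.+1 + m.+1)%N.
have [|a [a0 ae]] := @small_conjugates (e / d%:R).
  by rewrite divr_gt0 // ltr0n.
(* The value prescribed at x_0 is arbitrary. *)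
pose v (j : 'I_m.+1) : C :=
  if unlift ord0 j is Some i then w i / ev a (x j) else 0.
have [q sq qv] := real_interpolation v injx xNJ.
have [p pq] := rounding q; exists (a * p) => j.
have aj0 : ev a (x (lift ord0 j)) != 0 by rewrite ev_eq0.
have -> : w j = ev a (x (lift ord0 j)) * evR q (x (lift ord0 j)).
  by rewrite qv /v liftK mulrC divfK.
rewrite rmorphM hornerM -mulrBr normrM.
have -> : e%:C%C = (e / d%:R)%:C%C * d%:R.
  by rewrite -(rmorph_nat (real_complex R)) -rmorphM /= divfK ?pnatr_eq0.
rewrite (le_lt_trans (ler_wpM2l _ (_ : _ <= d%:R))) //.
  by rewrite (le_trans (pq _ _)) // ler_nat.
by rewrite ltr_pM2r ?ltr0n.
Qed.

(** Reduction modulo the monic [Phi] leaves 2(m + 1) integer coefficients without changing the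
    values. These are bounded in terms of the values at the [x j] and their conjugates, so finitely
    many remainders occur. *)
Lemma finite_bounded_conjugates (Phi : {poly int}) (B : C) :
  Phi \is monic -> (size Phi <= (m.+1 + m.+1).+1)%N -> ev Phi (x ord0) = 0 ->
  finite_set [set z | exists2 p, z = ev p (x ord0) &
    forall j, `|ev p (x j)| <= B].
Proof.
move=> mPhi sPhi Phi0; pose d := (m.+1 + m.+1)%N.
have [K K0 coefK] := coef_le_values (conj_points_inj injx xNJ).
pose N := absz (Num.ceil (complex.Re (K * B))).
(* Coefficients between -N and N are encoded as ordinals by a shift of [N]. *)
pose P (f : {ffun 'I_d -> 'I_N.*2.+1}) : {poly int} :=
  \poly_(i < d) ((f (inord i) : nat)%:Z - N%:Z).
apply: (@sub_finite_set _ _ [set ev (P f) (x ord0) | f in setT]); last first.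
  exact/finite_image/finite_finset.
move=> _ [p -> pB]; pose r := Pdiv.Ring.rmodp p Phi.
have prj j : ev p (x j) = ev r (x j).
  have /eqP Phij : ev Phi (x j) == 0 by rewrite ev_eq0 Phi0.
  rewrite {1}(Pdiv.RingMonic.rdivp_eq mPhi p) rmorphD rmorphM hornerD hornerM.
  by rewrite Phij mulr0 add0r.
have sr : (size r <= d)%N.
  rewrite -ltnS (leq_trans _ sPhi) // Pdiv.Ring.ltn_rmodpN0 //.
  exact: monic_neq0.
have rN i : (absz (r`_i)%R <= N)%N.
  have [id|id] := ltnP i d; last by rewrite nth_default ?(leq_trans sr).
  have := coefK (map_poly intr r) B (leq_trans (size_poly _ _) sr) _
    (Ordinal id).
  rewrite coef_map /= -intr_norm -(rmorph_int (real_complex R)) lecE /=.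
  have h j : `|(map_poly intr r).[conj_points x 0 j]| <= B.
    rewrite -[j]splitK; case: (fintype.split j) => {}j /=; rewrite /conj_points.
      by rewrite row_mxEl mxE -prj pB.
    by rewrite row_mxEr mxE -conj_ev normcJ -prj pB.
  move=> /(_ h)/andP[_ rK].
  have := le_trans rK (ceil_ge _); rewrite ler_int => rN.
  by rewrite -lez_nat (le_trans rN) // lez_abs.
exists [ffun i : 'I_d => inord (absz (r`_i + N%:Z))] => //.
rewrite prj; congr (map_poly _ _).[_].
apply/polyP => i; rewrite coef_poly; case: ltnP => id; last first.
  by rewrite nth_default ?(leq_trans sr).
rewrite ffunE !inordK //; last first.
  by have := rN i; lia.
rewrite gez0_abs ?addrK //.
by have := rN i; lia.
Qed.

End Approximation.

(** * Discs, reflections and X-rays *)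

Section Circle.
Context {R : realType}.
Local Notation C := (R[i]^o).

(** The squared modulus as an element of [R], whereas the norm of [R[i]] takes values in [R[i]]. *)
Definition sqnorm (z : C) : R := complex.Re z ^+ 2 + complex.Im z ^+ 2.

Lemma sqnormE (z : C) : (sqnorm z)%:C%C = `|z| ^+ 2.
Proof. exact: add_Re2_Im2. Qed.

(** Here [rho] is the square of the radius. *)
Definition disc (z0 : C) (rho : R) : set C := [set z | sqnorm (z - z0) <= rho].

(** Strict convexity: a proper convex combination of two distinct points of the disc lies in its
    interior, hence outside [V]. *)
Lemma convex_discD (z0 : C) (rho : R) (V : set C) :
  (forall z, V z -> sqnorm (z - z0) = rho) ->
  @convex_set R (Rcomplex R) (disc z0 rho `\` V).
Proof.
move=> Vrho; apply/convex_setW => x y /set_mem[xD xV] /set_mem[yD yV].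
move=> k k0 k1; apply/mem_set.
have [->|xy] := eqVneq x y; first by rewrite convmm.
suff lt_rho : sqnorm ((conv k x y : C) - z0) < rho.
  split; first exact: ltW.
  by move/Vrho => e; rewrite e ltxx in lt_rho.
have : 0 < sqnorm (x - y : C).
  by rewrite -ltcR sqnormE exprn_gt0 // normr_gt0 subr_eq0.
move: k0 k1 xD yD; rewrite /disc /conv /=.
move: (k%:num) => t; clear.
case: x y z0 => [x1 x2] [y1 y2] [z1 z2]; rewrite /sqnorm /=.
rewrite /unstable.onem => t0 t1 xD yD xy.
have -> : (t * x1 + (1 - t) * y1 - z1) ^+ 2 + (t * x2 + (1 - t) * y2 - z2) ^+ 2
  = t * ((x1 - z1) ^+ 2 + (x2 - z2) ^+ 2)
    + (1 - t) * ((y1 - z1) ^+ 2 + (y2 - z2) ^+ 2)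
    - t * (1 - t) * ((x1 - y1) ^+ 2 + (x2 - y2) ^+ 2) by ring.
have t1' : 0 < 1 - t by rewrite subr_gt0.
have := mulr_gt0 (mulr_gt0 t0 t1') xy.
have := ler_wpM2l (ltW t0) xD; have := ler_wpM2l (ltW t1') yD.
lra.
Qed.

(** For a unit vector [u], the reflection across the line through [z0] orthogonal to [u]. *)
Definition reflection (u z0 z : C) : C := z0 - u ^+ 2 * (z - z0)^*%C.

Lemma reflectionK (u z0 : C) : `|u| = 1 -> involutive (reflection u z0).
Proof.
move=> u1 z; rewrite /reflection addrAC subrr add0r rmorphN rmorphM rmorphXn /=.
rewrite conjcK mulrN opprK mulrA -exprMn -sqr_normc u1 !expr1n mul1r.
by rewrite addrC subrK.
Qed.

Lemma reflectionE (u z0 z : C) : `|u| = 1 ->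
  reflection u z0 z = z - (2 * complex.Re (u^*%C * (z - z0)))%:C%C * u.
Proof.
move=> u1; rewrite rmorphM /= rmorph_nat -addcJ rmorphM /= conjcK.
have uJ : u^*%C * u = 1 by rewrite mulrC -sqr_normc u1 expr1n.
rewrite mulrDl mulrAC uJ mul1r mulrAC -expr2 opprD addrA subKr.
by [].
Qed.

Lemma reflection_line (u z0 z : C) (l : lines u) :
  `|u| = 1 -> set_val l z -> set_val l (reflection u z0 z).
Proof.
move=> u1; rewrite /set_val /=; have [a _ <-] := set_valP l => -[c _ <-].
rewrite reflectionE //.
set r := 2 * _; exists (c - r) => //.
by rewrite rmorphB mulrBl addrA.
Qed.

(** The reflection maps every line in direction [u] to itself and exchanges [E] and [O], so each
    such line loses equally many points in both cases. *)
Lemma Xray_setD_reflection (u z0 : C) (S E O : set C) :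
  `|u| = 1 -> finite_set S -> E `<=` S -> O `<=` S ->
  (forall z, E z -> O (reflection u z0 z)) ->
  (forall z, O z -> E (reflection u z0 z)) ->
  @Xray R u (S `\` E) = @Xray R u (S `\` O).
Proof.
move=> u1 finS ES OS EO OE; apply/funext => l; rewrite /Xray.
have finI A B : A `<=` S -> finite_set (A `&` B : set C).
  by move=> AS; apply: sub_finite_set finS => z [/AS].
have cardD A : A `<=` S -> #|` fset_set ((S `\` A) `&` set_val l)| =
    (#|` fset_set (S `&` set_val l)| - #|` fset_set (A `&` set_val l)|)%N.
  move=> AS; have -> : (S `\` A) `&` set_val l =
      (S `&` set_val l) `\` (A `&` set_val l).
    apply/seteqP; split=> z /= [].
      by move=> [Sz nAz] lz; split=> // -[].
    by move=> [Sz lz] nA; split=> //; split=> // Az; apply: nA.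
  rewrite fset_setD; [|exact: finI..].
  rewrite cardfsD -fset_setI; [|exact: finI..].
  congr (_ - #|` fset_set _|)%N; apply/seteqP; split=> z /=; first by case.
  by move=> [Az lz]; split=> //; split=> //; apply: AS.
rewrite !cardD //; congr (_ - _)%N.
have -> : O `&` set_val l = reflection u z0 @` (E `&` set_val l).
  apply/seteqP; split=> z /=.
    move=> [Oz lz]; exists (reflection u z0 z); last by rewrite reflectionK.
    by split; [exact: OE|exact: reflection_line].
  by move=> [y [Ey ly] <-]; split; [exact: EO|exact: reflection_line].
rewrite fset_set_image; last exact: finI.
by rewrite card_imfset //; apply/inv_inj/reflectionK.
Qed.

Lemma circle_not_determined (L U E O : set C) (z0 e : C) (rho : R) :
  E `<=` L -> O `<=` L ->
  (forall z, (E `|` O) z -> sqnorm (z - z0) = rho) ->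
  E e -> ~ O e -> finite_set (L `&` disc z0 rho) ->
  (forall u, U u -> [/\ `|u| = 1,
    forall z, E z -> O (reflection u z0 z) &
    forall z, O z -> E (reflection u z0 z)]) ->
  ~ determined_by_Xrays (convex_subsets L) U.
Proof.
move=> EL OL EOrho Ee nOe finD UP; set S := L `&` disc z0 rho in finD.
have conv V : (forall z, V z -> sqnorm (z - z0) = rho) ->
    convex_subsets L (S `\` V).
  move=> Vrho; split; first by apply: sub_finite_set finD => z [].
    by move=> z [[]].
  apply/seteqP; split=> z.
    move=> Sz; split; last by case: Sz => -[].
    exact: sub_gen_smallest.
  move=> [hz Lz].
  (* The hull is contained in every convex superset, in particular in the disc without [V]. *)
  have [Dz nVz] : (disc z0 rho `\` V) z.
    apply: hz; split; first exact: convex_discD.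
    by move=> y [[_ Dy] nVy].
  by [].
have sub V : V `<=` L -> (forall z, V z -> sqnorm (z - z0) = rho) -> V `<=` S.
  by move=> VL Vrho z Vz; split; [exact: VL|rewrite /disc /= Vrho].
have Erho z : E z -> sqnorm (z - z0) = rho by move=> ?; apply: EOrho; left.
have Orho z : O z -> sqnorm (z - z0) = rho by move=> ?; apply: EOrho; right.
move=> /(_ _ _ (conv _ Erho) (conv _ Orho)) h.
(* The point [e] survives the deletion of [O] but not that of [E]. *)
have : (S `\` O) e by split=> //; apply: (sub _ EL Erho).
rewrite -h => [[]//|u /UP[u1 EO OE]].
exact: (@Xray_setD_reflection _ z0 _ _ _ u1 finD (sub _ EL Erho)
  (sub _ OL Orho)).
Qed.

Lemma parallel_reflection (u z0 z : C) :
  `|u| = 1 -> reflection u z0 z != z -> parallel (z - reflection u z0 z) u.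
Proof.
move=> u1; rewrite reflectionE // subKr; set r := 2 * _ => rz.
have r0 : r != 0 by apply: contraNneq rz => ->; rewrite mul0r subr0.
exists r^-1; first by rewrite invr_eq0.
by rewrite mulrA -rmorphM mulVf // mul1r.
Qed.

(** Parallel unit vectors differ by a sign only, so squares tell directions apart. *)
Lemma parallel_sqr (u v : C) : `|u| = 1 -> `|v| = 1 -> parallel u v ->
  u ^+ 2 = v ^+ 2.
Proof.
move=> u1 v1 [c c0 vE]; have := v1.
rewrite vE normrM u1 mulr1 normc_def /= expr0n addr0 sqrtr_sqr.
move=> /complexI c1; rewrite exprMn -rmorphXn /= -(real_normK (num_real c)).
by rewrite c1 expr1n mul1r.
Qed.

End Circle.

(* -1 has order 2 in the group of units modulo n. *)
Lemma totient_even n : (2 < n)%N -> ~~ odd (totient n).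
Proof.
move=> n2; have n1 : (1 < n)%N by apply: ltnW.
rewrite -dvdn2 -card_units_Zp; last exact: ltnW.
have u1 : (-1 : 'Z_n) \is a GRing.unit by exact: unitrN1.
pose x : {unit 'Z_n} := FinRing.Unit u1.
have xx : (x ^+ 2 = 1)%g by apply/val_inj; rewrite /= mulrNN mulr1.
have x1 : x != 1%g.
  apply/negP => /eqP/(congr1 val)/= /eqP; rewrite eq_sym -addr_eq0 => /eqP.
  by move/(congr1 val); rewrite /= !Zp_cast // !modn_small.
rewrite -(nt_prime_order _ xx x1) //.
by apply: order_dvdG; rewrite inE.
Qed.

(** * Primitivity of [zeta] and its cyclotomic polynomial *)

Section CyclotomicField.
Context {R : realType}.
Local Notation C := (R[i]^o).
Local Notation ev p z := (map_poly (intr : int -> R[i]) p).[z].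

Lemma zetaX n k :
  (@zeta R n) ^+ k =
  (cos (2 * pi / n%:R *+ k) +i* sin (2 * pi / n%:R *+ k))%C.
Proof.
elim: k => [|k IH]; first by rewrite expr0 !mulr0n cos0 sin0.
rewrite exprS IH /zeta [_ *+ k.+1]mulrS cosD sinD.
by apply/eqP; rewrite eq_complex /=; apply/andP; split; apply/eqP; ring.
Qed.

(** An order k < n would give cos(2 pi k / n) = 1, hence sin(pi k / n) = 0, although this angle lies
    strictly between 0 and pi. *)
Lemma zeta_prim_root n : (0 < n)%N -> n.-primitive_root (@zeta R n : R[i]).
Proof.
move=> n0; have n0R : n%:R != 0 :> R by rewrite pnatr_eq0 -lt0n.
have zn : (@zeta R n) ^+ n = 1.
  rewrite zetaX -[in LHS]mulr_natr divfK // mulr_natl cos2pi sin_mulr2n sinpi.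
  by rewrite mulr0 mul0rn.
have [k zk] := @prim_order_exists _ n (zeta n : R[i]) n0 zn => kn.
have k0 := prim_order_gt0 zk.
have : (k <= n)%N by apply: dvdn_leq.
rewrite leq_eqVlt => /predU1P[e|ltkn]; first by rewrite -{1}e.
have := prim_expr_order zk; rewrite zetaX => -[+ _].
have -> : 2 * pi / n%:R *+ k = (pi * (k%:R / n%:R)) *+ 2 :> R.
  by rewrite -[in LHS]mulr_natr -[in RHS]mulr_natr; ring.
rewrite cos_mulr2n cos2sin2 => c1.
have : 0 < sin (pi * (k%:R / n%:R)) :> R.
  apply: sin_gt0_pi; apply/andP; split.
    by rewrite mulr_gt0 ?pi_gt0 // divr_gt0 ?ltr0n.
  by rewrite gtr_pMr ?pi_gt0 // ltr_pdivrMr ?ltr0n // mul1r ltr_nat.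
by move=> /(exprn_gt0 2); lra.
Qed.

(** As a root of X^n - 1, [zeta] is a root of some Phi_d with d dividing n. Then zeta^d = 1, and
    primitivity forces d = n. *)
Lemma Cyclotomic_zeta n : (0 < n)%N -> ev 'Phi_n (@zeta R n) = 0.
Proof.
move=> n0; have zn := zeta_prim_root n0.
have /eqP : ev (\prod_(d <- divisors n) 'Phi_d) (@zeta R n) = 0.
  rewrite prod_Cyclotomic // rmorphB /= map_polyXn rmorph1 !hornerE.
  by rewrite (prim_expr_order zn) subrr.
rewrite rmorph_prod horner_prod prodf_seq_eq0 => /hasP[d dn /= /eqP Phid].
have {}dn : (d %| n)%N by rewrite dvdn_divisors.
have d0 : (0 < d)%N by apply: dvdn_gt0 dn.
suff nd : n = d by rewrite {1}nd.
apply/eqP; rewrite eqn_dvd dn andbT (prim_order_dvd zn) -subr_eq0.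
have /(congr1 (fun p => ev p (@zeta R n))) := prod_Cyclotomic d0.
rewrite (big_rem d) /= -?dvdn_divisors // rmorphM hornerM Phid mul0r.
by rewrite rmorphB /= map_polyXn rmorph1 !hornerE => <-.
Qed.

End CyclotomicField.

(** * Automorphisms of the cyclotomic field and their values at [zeta] *)

Section Automorphisms.
Context {R : realType}.
Local Notation C := (R[i]^o).
Local Notation ev p z := (map_poly (intr : int -> R[i]) p).[z].
Variable n : nat.
Local Notation K := (@cyclotomic_field R n).
Local Notation zeta := (@zeta R n).

Lemma cyclotomic_field_closed : divring_closed (mem K).
Proof.
split.
- by apply/mem_set => F [[F1 _ _] _]; apply/set_mem.
- move=> x y /set_mem Kx /set_mem Ky; apply/mem_set => F FP.
  have [_ FB _] := FP.1; apply/set_mem; apply: FB; apply/mem_set.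
    exact: Kx.
  exact: Ky.
- move=> x y /set_mem Kx /set_mem Ky; apply/mem_set => F FP.
  have [_ _ FM] := FP.1; apply/set_mem; apply: FM; apply/mem_set.
    exact: Kx.
  exact: Ky.
Qed.

Lemma cyclotomic_field_zeta : zeta \in K.
Proof. by apply/mem_set => F [_]; apply. Qed.

Let K1 : 1 \in K. Proof. by case: cyclotomic_field_closed. Qed.
Let KB x y : x \in K -> y \in K -> x - y \in K.
Proof. by case: cyclotomic_field_closed => _ + _; apply. Qed.
Let KV x y : x \in K -> y \in K -> x / y \in K.
Proof. by case: cyclotomic_field_closed => _ _; apply. Qed.
Let K0 : 0 \in K. Proof. by rewrite -(subrr 1) KB. Qed.
Let KD x y : x \in K -> y \in K -> x + y \in K.
Proof. by move=> Kx Ky; rewrite -[y]opprK KB // -sub0r KB. Qed.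
Let KM x y : x \in K -> y \in K -> x * y \in K.
Proof. by move=> Kx Ky; rewrite -[y]invrK KV // -div1r KV. Qed.
Let Knat k : k%:R \in K.
Proof. by elim: k => [//|k IH]; rewrite -natr1 KD. Qed.
Let Kint (k : int) : k%:~R \in K.
Proof.
case: k => k; first exact: Knat.
by rewrite NegzE mulrNz -sub0r; apply: KB; last exact: Knat.
Qed.

Lemma cyclotomic_field_ev p : ev p zeta \in K.
Proof.
elim/poly_ind: p => [|p c IH]; first by rewrite map_poly0 horner0.
rewrite rmorphD rmorphM /= map_polyX map_polyC /= hornerMXaddC.
by rewrite KD ?KM ?cyclotomic_field_zeta.
Qed.

(** The image is not confined to [K], so composing with complex conjugation does not call for
    showing that [K] is stable under it. *)
Definition field_morphism (f : C -> C) : Prop :=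
  [/\ f 1 = 1, {in K &, forall x y, f (x + y) = f x + f y} &
               {in K &, forall x y, f (x * y) = f x * f y}].

Lemma automorphism_morphism f : cyclotomic_automorphism n f -> field_morphism f.
Proof.
by move=> [_ fQ fD fM]; split=> //; have := fQ 1; rewrite rmorph1.
Qed.

Lemma conj_morphism f :
  field_morphism f -> field_morphism (fun z => (f z)^*%C).
Proof.
move=> [f1 fD fM]; split=> [|x y Kx Ky|x y Kx Ky]; first by rewrite f1 rmorph1.
  by rewrite fD // rmorphD.
by rewrite fM // rmorphM.
Qed.

Lemma morphism0 f : field_morphism f -> f 0 = 0.
Proof.
by move=> [_ fD _]; apply: (addIr (f 0)); rewrite -fD // !add0r.
Qed.

Lemma morphismB f x y : field_morphism f -> x \in K -> y \in K ->
  f (x - y) = f x - f y.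
Proof.
move=> fmorph Kx Ky; have [_ fD _] := fmorph; apply: (addIr (f y)).
by rewrite -fD ?KB // !subrK.
Qed.

Lemma morphism_div f x y : field_morphism f -> x \in K -> y \in K ->
  f (x / y) = f x / f y.
Proof.
move=> fmorph Kx Ky; have [f1 _ fM] := fmorph.
(* For [y = 0] both sides are 0, by the convention that 0 is its own inverse. *)
have [->|y0] := eqVneq y 0.
  by rewrite invr0 mulr0 morphism0 // invr0 mulr0.
have KVy : y^-1 \in K by rewrite -div1r KV.
have fy : f y^-1 * f y = 1 by rewrite -fM // mulVf.
have fy0 : f y != 0.
  by apply: contra_eqN fy => /eqP ->; rewrite mulr0 eq_sym oner_eq0.
by rewrite fM //; congr (_ * _); apply: (mulIf fy0); rewrite fy mulVf.
Qed.

Lemma morphism_ev f p : field_morphism f -> f (ev p zeta) = ev p (f zeta).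
Proof.
move=> fmorph; have [f1 fD fM] := fmorph.
have fnat k : f k%:R = k%:R.
  by elim: k => [|k IH]; rewrite ?morphism0 // -natr1 fD // IH f1.
have fint (k : int) : f k%:~R = k%:~R.
  case: k => k; first exact: fnat.
  have Kk : (k.+1%:Z)%:~R \in K by exact: Knat.
  rewrite NegzE mulrNz -sub0r morphismB // morphism0 //.
  by congr (_ - _); exact: fnat.
elim/poly_ind: p => [|p c IH].
  by rewrite map_poly0 !horner0 morphism0.
rewrite rmorphD rmorphM /= map_polyX map_polyC /= !hornerMXaddC.
have Kp := cyclotomic_field_ev p; have Kz := cyclotomic_field_zeta.
by rewrite fD ?KM // fM // IH fint.
Qed.

(** The elements of [K] on which [f] and [g] agree form a subfield containing [zeta], and [K] is the
    smallest one. *)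
Lemma morphism_eq f g : field_morphism f -> field_morphism g ->
  f zeta = g zeta -> {in K, f =1 g}.
Proof.
move=> fmorph gmorph fg.
have sub : K `<=` [set z | z \in K /\ f z = g z].
  apply: smallest_sub; last first.
    by move=> _ ->; split; rewrite ?cyclotomic_field_zeta.
  have [[f1 _ _] [g1 _ _]] := (fmorph, gmorph).
  split; first by apply/mem_set => /=; rewrite f1 g1.
    move=> x y /set_mem[Kx fx] /set_mem[Ky fy]; apply/mem_set; split.
      exact: KB.
    by rewrite !morphismB // fx fy.
  move=> x y /set_mem[Kx fx] /set_mem[Ky fy]; apply/mem_set; split.
    exact: KV.
  by rewrite !morphism_div // fx fy.
by move=> z /set_mem/sub[].
Qed.

Hypothesis n3 : (2 < n)%N.
Let n0 : (0 < n)%N. Proof. by apply: leq_trans n3. Qed.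

Lemma automorphism_zetaX f k : cyclotomic_automorphism n f ->
  f (zeta ^+ k) = f zeta ^+ k.
Proof.
move=> /automorphism_morphism/(morphism_ev 'X^k).
by rewrite map_polyXn !hornerXn.
Qed.

Lemma automorphism_inj f : cyclotomic_automorphism n f -> {in K &, injective f}.
Proof. by move=> [[_ + _]]. Qed.

Lemma norm_automorphism_zeta f : cyclotomic_automorphism n f -> `|f zeta| = 1.
Proof.
move=> fa; have [f1 _ _] := automorphism_morphism fa.
apply/eqP; rewrite -(@pexpr_eq1 _ _ n) // -normrX -automorphism_zetaX //.
by rewrite (prim_expr_order (zeta_prim_root n0)) f1 normr1.
Qed.

(** A real number of modulus 1 has square 1; injectivity would then give zeta^2 = 1, against the
    order n > 2. *)
Lemma automorphism_zetaJ f :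
  cyclotomic_automorphism n f -> f zeta != (f zeta)^*%C.
Proof.
move=> fa; apply/eqP => fJ; have [f1 _ _] := automorphism_morphism fa.
have : f (zeta ^+ 2) = f 1.
  rewrite automorphism_zetaX // expr2 {2}fJ -sqr_normc.
  by rewrite norm_automorphism_zeta ?expr1n.
move=> /(automorphism_inj fa); rewrite expr2 KM ?cyclotomic_field_zeta //.
move=> /(_ isT K1)/eqP; rewrite -expr2 -(prim_order_dvd (zeta_prim_root n0)).
by move=> /(@dvdn_leq _ 2 isT); rewrite leqNgt n3.
Qed.

Variable s : 'I_(internal_dim n).+1 -> C -> C.
Hypothesis s_repr : conjugate_representatives s.
Let s_aut j : cyclotomic_automorphism n (s j). Proof. by case: s_repr. Qed.

(** Both [i] and [j] index a representative of the conjugate pair of [s j], and this index is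
    unique. *)
Lemma representatives_eq i j :
  {in K, s i =1 s j} \/ {in K, s i =1 fun z => (s j z)^*%C} -> i = j.
Proof.
case: s_repr => _ _ /(_ _ (s_aut j))[j' [_ uniq]] /uniq <-.
by apply: uniq; left.
Qed.

Lemma representatives_zeta_inj : injective (fun j => s j zeta : R[i]).
Proof.
move=> i j e; apply: representatives_eq; left; apply: morphism_eq e => //;
  exact: automorphism_morphism.
Qed.

Lemma representatives_zetaJ i j : (s i zeta : R[i]) != (s j zeta)^*%C.
Proof.
apply/eqP => e; have ij : i = j.
  apply: representatives_eq; right; apply: morphism_eq e.
    exact: automorphism_morphism.
  exact/conj_morphism/automorphism_morphism.
by move: e; rewrite ij => /eqP; apply/negP/automorphism_zetaJ.
Qed.

(** An injective morphism vanishes only at 0, so both sides amount to the vanishing of [p] at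
    [zeta]. *)
Lemma representatives_ev_eq0 p j :
  (ev p (s j zeta) == 0) = (ev p (s ord0 zeta) == 0).
Proof.
have eq0 i : (ev p (s i zeta) == 0) = (ev p zeta == 0).
  have smorph := automorphism_morphism (s_aut i).
  rewrite -morphism_ev // -{1}(morphism0 smorph).
  apply/eqP/eqP => [e|->//].
  have inj := automorphism_inj (s_aut i).
  exact: (inj _ _ (cyclotomic_field_ev p) K0 e).
by rewrite !eq0.
Qed.

Lemma representatives_zeta0 : s ord0 zeta = zeta.
Proof. by case: s_repr => -> //; exact: cyclotomic_field_zeta. Qed.

End Automorphisms.

(** * Inner balls and boundedness of windows *)

Section Window.
Context {R : realType}.
Local Notation C := (R[i]^o).

Lemma window_ball m (W : set 'rV[C]_m) : window W ->
  exists (w0 : 'rV[C]_m) (e : R), 0 < e /\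
    forall w : 'rV[C]_m, (forall j, `|w 0 j - w0 0 j| < e%:C%C) -> W w.
Proof.
move=> [[w0 w0W] _ _ _]; exists w0.
have /nbhs_ballP[e /= e0 eW] : nbhs w0 W by [].
(* Radii are elements of [R[i]]; a positive one is real. *)
have eR : e = (complex.Re e)%:C%C by rewrite RRe_real // gtr0_real.
exists (complex.Re e); rewrite -ltcR -eR; split=> // w we; apply: eW.
by split=> // i j; rewrite ord1 -ball_normE /= distrC.
Qed.

Lemma window_bounded m (W : set 'rV[C]_m) : window W ->
  exists B : R, forall w : 'rV[C]_m, W w -> forall j, `|w 0 j| <= B%:C%C.
Proof.
move=> [_ _ Wcl]; rewrite compact_cover => cW.
(* Finitely many unit balls cover the window; adding up the entries of all their centres, plus 1,
   gives a common bound. *)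
have [||D _ WD] := cW _ setT (fun w : 'rV[C]_m => (ball w (1 : C))°).
- by move=> w _; exact: open_interior.
- move=> w _; exists w => //.
  exact: (@open_nbhs_ball _ _ w 1%:pos).2.
pose b (w : 'rV[C]_m) : R := \sum_j complex.Re `|w 0 j|.
have bE (w : 'rV[C]_m) : (b w)%:C%C = \sum_j `|w 0 j|.
  rewrite /b rmorph_sum; apply: eq_bigr => j _.
  exact: RRe_real (normr_real _).
exists (\sum_(w <- D) b w + 1) => w /Wcl/WD[w0 /= w0D /interior_subset].
move=> [_ /(_ ord0) h] j; have := h j; rewrite -ball_normE /= => w0w.
rewrite rmorphD rmorph1 rmorph_sum /= -[w 0 j](subrK (w0 0 j)).
rewrite (le_trans (ler_normD _ _)) // addrC lerD //; last first.
  by rewrite distrC ltW.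
rewrite (big_rem w0) //= bE (bigD1 j) //= -addrA lerDl.
by rewrite addr_ge0 ?sumr_ge0 // => v _; rewrite bE sumr_ge0.
Qed.

End Window.

(** * Two convex subsets with equal X-rays in k <= n directions *)

Section NotDetermined.
Context {R : realType}.
Local Notation C := (R[i]^o).
Local Notation ev p z := (map_poly (intr : int -> R[i]) p).[z].

(** A crude bound from a <= a^2 + 1, which avoids square roots. *)
Lemma norm_le_of_sqr (y : C) (r : R) :
  `|y| ^+ 2 <= r%:C%C -> `|y| <= (r + 1)%:C%C.
Proof.
have [a a0 ->] : exists2 a : R, 0 <= a & `|y| = a%:C%C.
  exists (complex.Re `|y|); last by rewrite RRe_real ?normr_real.
  by have := normr_ge0 y; rewrite lecE => /andP[].
by rewrite -rmorphXn !lecR /=; nra.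
Qed.

Lemma norm_zeta n : `|@zeta R n| = 1.
Proof. by rewrite normc_def /= cos2Dsin2 sqrtr1. Qed.

(* If M + zeta were equal to its conjugate up to a power of zeta for every M,
   two distinct M would share the same power, which would then be 1. *)
Lemma exists_chiral n : (2 < n)%N ->
  exists M : nat, forall j,
    M%:R + @zeta R n <> (M%:R + zeta n)^*%C * zeta n ^+ j.
Proof.
move=> n3; have n0 : (0 < n)%N by apply: leq_trans n3.
have zn := @zeta_prim_root R n n0.
apply: contrapT => /forallNP H.
have /choice[f fE] : forall M : nat, exists j : 'I_n,
    M%:R + @zeta R n = (M%:R + zeta n)^*%C * zeta n ^+ j.
  move=> M; have /existsNP[j /contrapT jE] := H M.
  have jn : (j %% n < n)%N by rewrite ltn_mod.
  by exists (Ordinal jn); rewrite /= (prim_expr_mod zn).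
have /injectivePn[M [M' MM' ff']] : ~~ injectiveb (fun M : 'I_n.+1 => f M).
  by apply/negP => /injectiveP /leq_card; rewrite !card_ord ltnn.
have MM0 : M%:R - M'%:R != 0 :> C.
  by rewrite subr_eq0 eqr_nat; apply: contraNneq MM' => /val_inj ->.
have zf : zeta n ^+ f M = 1 :> C.
  apply: (mulfI MM0); rewrite mulr1.
  have -> : M%:R - M'%:R = (M%:R + zeta n) - (M'%:R + zeta n) :> C by ring.
  rewrite {2}(fE M) {2}(fE M') -ff' -mulrBl.
  congr (_ * _).
  rewrite !rmorphD !rmorph_nat /=; ring.
have := fE M; rewrite zf mulr1 rmorphD rmorph_nat => /addrI zJ.
have : zeta n ^+ 2 = 1 :> C.
  by rewrite expr2 {2}zJ -sqr_normc norm_zeta expr1n.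
move=> /eqP; rewrite -(prim_order_dvd zn).
by move=> /(@dvdn_leq _ 2 isT); rewrite leqNgt n3.
Qed.

Lemma zetaJ n : (0 < n)%N -> (@zeta R n)^*%C = zeta n ^+ n.-1.
Proof.
move=> n0; have z0 : @zeta R n != 0 by rewrite -normr_gt0 norm_zeta.
apply: (mulfI z0); rewrite -sqr_normc norm_zeta expr1n -exprS prednK //.
by rewrite (prim_expr_order (zeta_prim_root n0)).
Qed.

(** The construction provides n pairwise non-parallel directions, of which the first [k] are
    kept. *)
Lemma cyclotomic_model_set_not_determined n (L : set C) k :
  (3 <= n)%N -> cyclotomic_model_set n L -> (k <= n)%N ->
  exists U : set C, [/\ (U #= `I_k)%card, U `<=` model_direction L,
    (forall u v, U u -> U v -> u <> v -> ~ parallel u v) &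
    ~ determined_by_Xrays (convex_subsets L) U].
Proof.
move=> n3 [s [t [W [s_repr winW LE]]]] kn.
have n0 : (0 < n)%N by apply: leq_trans n3.
pose x j : R[i] := s j (zeta n).
have injx : injective x := representatives_zeta_inj s_repr.
have xNJ := representatives_zetaJ n3 s_repr.
have x1 j : `|x j| = 1.
  by have [_ sa _] := s_repr; apply: norm_automorphism_zeta.
have x_le1 j : `|x j| <= 1 by rewrite x1.
have ev_eq0 := representatives_ev_eq0 s_repr.
have x0 : x ord0 = zeta n := representatives_zeta0 s_repr.
have sE p j : s j (ev p (zeta n)) = ev p (x j).
  by have [_ sa _] := s_repr; apply/morphism_ev/automorphism_morphism.
have LP z : L (t + z) <-> exists2 p, z = ev p (zeta n) &
    W (\row_j ev p (x (lift ord0 j))).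
  have starE p : star_map s (ev p (zeta n)) = \row_j ev p (x (lift ord0 j)).
    by apply/rowP => j; rewrite !mxE sE.
  rewrite LE; split.
    by move=> [y [[p ->]]] + /addrI <-; rewrite starE; exists p.
  by move=> [p -> Wp]; exists (ev p (zeta n)) => //; split;
    [exists p|rewrite starE].
have [w0 [e [e0 We]]] := window_ball winW.
have [B WB] := window_bounded winW.
have [M Mchiral] := exists_chiral n3.
(* The star image of the centre is placed within e / 2 of [w0]. The other half of the margin is left
   to the vertices: the conjugates of (M + zeta^i) zeta^j have modulus at most M + 1, whence the
   bound on [pa]. *)
have [p0 p0w] := dense_conjugates injx xNJ x_le1 ev_eq0 (fun j => w0 0 j)
  (divr_gt0 e0 (ltr0n R 2)).
have [|pa pa0 pae] := small_conjugates injx xNJ x_le1 (e := e / 2 / M.+1%:R).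
  by rewrite !divr_gt0 // ltr0n.
set al := ev pa _ in pa0; pose a : C := M%:R + zeta n.
pose z0 := t + ev p0 (zeta n).
(* The exponent i = 1 yields the orbit of [a], and i = n - 1 that of its conjugate. *)
have Lvertex (i j : nat) : L (z0 + al * ((M%:R + zeta n ^+ i) * zeta n ^+ j)).
  rewrite /z0 -addrA; apply/LP; exists (p0 + pa * ((M%:R + 'X^i) * 'X^j)).
    by rewrite !(rmorphD, rmorphM) /= !map_polyXn rmorph_nat !hornerE /=
      hornerMn hornerE /al x0.
  apply: We => l; rewrite mxE; set y := x _.
  have -> : ev (p0 + pa * ((M%:R + 'X^i) * 'X^j)) y - w0 0 l =
      (ev p0 y - w0 0 l) + ev pa y * ((M%:R + y ^+ i) * y ^+ j).
    rewrite !(rmorphD, rmorphM) /= !map_polyXn rmorph_nat !hornerE /=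
      hornerMn hornerE.
    by rewrite addrAC.
  have e2 : e%:C%C = (e / 2)%:C%C + (e / 2 / M.+1%:R)%:C%C * M.+1%:R.
    rewrite -(rmorph_nat (real_complex R) M.+1) -rmorphM -rmorphD /=.
    by rewrite divfK ?pnatr_eq0 // -splitr.
  rewrite e2 (le_lt_trans (ler_normD _ _)) // ltr_leD //; first exact: p0w.
  rewrite normrM ler_pM //; first exact/ltW/pae.
  rewrite normrM normrX x1 expr1n mulr1 (le_trans (ler_normD _ _)) //.
  by rewrite normrX x1 expr1n normr_nat natr1.
pose E : set C := [set z0 + al * (a * zeta n ^+ j) | j in [set: nat]].
pose O : set C := [set z0 + al * (a^*%C * zeta n ^+ j) | j in [set: nat]].
have aJ : a^*%C = M%:R + zeta n ^+ n.-1.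
  by rewrite /a rmorphD rmorph_nat; congr (_ + _); exact: zetaJ.
have EL : E `<=` L by move=> _ [j _ <-]; have := Lvertex 1%N j; rewrite expr1.
have OL : O `<=` L by move=> _ [j _ <-]; rewrite aJ.
(* The reflection across the line through z0 orthogonal to u m maps
   z0 + al b to z0 + al (conj b) zeta^m. *)
pose u (m : nat) : C := sqrtc (- (zeta n ^+ m * (al / al^*%C))).
have u2 m : u m ^+ 2 = - (zeta n ^+ m * (al / al^*%C)) by exact: sqr_sqrtc.
have alJ0 : al^*%C != 0 by rewrite conjc_eq0.
have u1 m : `|u m| = 1.
  apply/eqP; rewrite -(@pexpr_eq1 _ _ 2) // -normrX u2 normrN !normrM normfV.
  by rewrite normcJ divff ?normr_eq0 // mulr1 normrX norm_zeta expr1n.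
have reflE m b :
    reflection (u m) z0 (z0 + al * b) = z0 + al * (b^*%C * zeta n ^+ m).
  have -> : reflection (u m) z0 (z0 + al * b) = z0 - u m ^+ 2 * (al * b)^*%C.
    by rewrite /reflection [z0 + al * b]addrC addrK.
  rewrite u2 mulNr opprK rmorphM /=; congr (_ + _).
  by rewrite -!mulrA mulKf // mulrCA [zeta n ^+ m * _]mulrC.
have conjM (b c : C) : (b * c)^*%C = b^*%C * c^*%C by exact: rmorphM.
have zXJ j : (zeta n ^+ j)^*%C = zeta n ^+ (n.-1 * j) :> C.
  by rewrite exprM -zetaJ // -rmorphXn.
have EO m z : E z -> O (reflection (u m) z0 z).
  move=> [j _ <-]; rewrite reflE; exists (n.-1 * j + m)%N => //.
  by rewrite conjM zXJ -mulrA -exprD.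
have OE m z : O z -> E (reflection (u m) z0 z).
  move=> [j _ <-]; rewrite reflE; exists (n.-1 * j + m)%N => //.
  by rewrite conjM conjcK zXJ -mulrA -exprD.
pose v0 := z0 + al * a.
have Ee : E v0 by exists 0%N => //; rewrite expr0 mulr1.
have nOe : ~ O v0.
  by move=> [j _ /addrI/(mulfI pa0)/esym]; apply: Mchiral.
(* The powers zeta^m with m < k <= n are distinct, which makes the directions [u m] pairwise
   non-parallel. *)
have u2_inj m m' : (m < k)%N -> (m' < k)%N -> u m ^+ 2 = u m' ^+ 2 -> m = m'.
  move=> mk m'k; rewrite !u2 => /oppr_inj/mulIf zz.
  have /eqP : zeta n ^+ m = zeta n ^+ m' :> C.
    by apply: zz; rewrite mulf_neq0 ?invr_eq0.
  rewrite (eq_prim_root_expr (zeta_prim_root n0)).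
  by rewrite !modn_small ?(leq_trans _ kn) // => /eqP.
(* The disc bounds the point itself and the window bounds its other conjugates. *)
have finD : finite_set (L `&` disc z0 (sqnorm (al * a))).
  apply: (@sub_finite_set _ _ ((fun z => t + z) @` [set z | exists2 p,
      z = ev p (x ord0) & forall j, `|ev p (x j)| <=
        (sqnorm (al * a) + 1 + `|B|)%:C%C + `|ev p0 (zeta n)|])).
    move=> y [Ly Dy]; exists (y - t); last by rewrite addrC subrK.
    have /LP[p yp Wp] : L (t + (y - t)) by rewrite addrC subrK.
    exists p; first by rewrite x0.
    have S0 : 0 <= sqnorm (al * a) by rewrite addr_ge0 ?sqr_ge0.
    move=> j; case: (unliftP ord0 j) => [i|] ->.
      have := WB _ Wp i; rewrite mxE => /le_trans; apply.
      rewrite -[leLHS]addr0 lerD // lecR.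
      by have := ler_norm B; lra.
    have -> : ev p (x ord0) = (y - z0) + ev p0 (zeta n).
      by rewrite x0 -yp /z0 opprD addrA subrK.
    rewrite (le_trans (ler_normD _ _)) // lerD2r.
    rewrite (@le_trans _ _ (sqnorm (al * a) + 1)%:C%C) //.
      by apply: norm_le_of_sqr; rewrite -sqnormE lecR.
    by rewrite lecR lerDl.
  apply: finite_image.
  apply: (finite_bounded_conjugates injx xNJ ev_eq0 _ (Cyclotomic_monic n)).
    (* Since phi(n) is even and at least 2, halving and predecessor lose nothing: 2(m + 1) = phi(n)
       for m = [internal_dim n]. *)
    rewrite size_Cyclotomic ltnS /internal_dim; have := totient_even n3.
    have := totient_gt1 n; rewrite n3; lia.
  by rewrite x0 Cyclotomic_zeta.
exists (u @` `I_k); split.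
- apply: inj_card_eq => m m' /set_mem mk /set_mem m'k uu.
  by apply: u2_inj; rewrite ?uu.
- move=> _ [m mk <-]; split=> //.
  (* The vertex [v0] and its mirror image are distinct points of [L] whose difference is parallel to
     [u m]. *)
  have nfix : reflection (u m) z0 v0 != v0.
    by apply/eqP => fix_e; apply: nOe; rewrite -fix_e; exact: EO.
  exists v0, (reflection (u m) z0 v0); split.
  + exact: EL.
  + exact/OL/EO.
  + by rewrite subr_eq0 eq_sym.
  + exact: parallel_reflection.
- move=> _ _ [m mk <-] [m' m'k <-] uu par; apply: uu.
  by congr u; apply: u2_inj => //; exact: parallel_sqr.
- apply: (circle_not_determined EL OL _ Ee nOe finD).
    move=> _ [[j _ <-]|[j _ <-]]; apply: complexI; rewrite !sqnormE addrC addKr;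
      by rewrite !normrM ?normcJ normrX norm_zeta expr1n mulr1.
  by move=> _ [m mk <-]; split; [exact: u1|exact: EO|exact: OE].
Qed.

End NotDetermined.

(* lcmn n 2 is even, so the natural-number division is exact. *)
Theorem corollary5p5 (R : realType) (n : nat) (hn : (3 <= n)%N)
    (L : set R[i]^o) (hL : cyclotomic_model_set n L)
    (k : nat) (hk : (0 < k)%N)
    (hdet : forall U : set R[i]^o,
      (U #= `I_k)%card ->
      U `<=` model_direction L ->
      (forall u v, U u -> U v -> u <> v -> ~ parallel u v) ->
      determined_by_Xrays (convex_subsets L) U) :
  (k > maxn 3 (lcmn n 2 %/ 2))%N.
Proof.
rewrite ltnNge; apply/negP => k_le.
have kn : (k <= n)%N.
  (* Both terms of the maximum are at most n, because lcm(n, 2) divides 2n. *)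
  apply: leq_trans k_le _; rewrite geq_max hn leq_divLR ?dvdn_lcmr //.
  rewrite dvdn_leq ?muln_gt0 ?(leq_trans _ hn) //.
  by rewrite dvdn_lcm dvdn_mulr ?dvdn_mull.
have [U [Uk UL Upar]] := cyclotomic_model_set_not_determined hn hL kn.
by apply; exact: hdet.
Qed.
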